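(* Let $G=(V,E)$ be a complete loopless directed graph with edge weights $w:E\to\{0,1\}$, let $M_{max}$ be a maximum weight matching of $G$, and let $G'$ be the undirected weighted graph constructed from $G$ and $M_{max}$ as described in the context. Then (1) every perfect matching of $G'$ yields (via the correspondence described in the context) a cycle cover of $G$ that evades $M_{max}$; and (2) a maximum weight perfect matching of $G'$ yields a cycle cover $C_{max}$ of $G$ that evades $M_{max}$ such that $w(C_{max})\ge \mathrm{OPT}$, where $\mathrm{OPT}$ is the maximum weight of a traveling salesman tour (directed Hamiltonian cycle) of $G$.
   Context: A matching of a directed graph is a set of pairwise vertex-disjoint edges; its weight is the sum of its edge weights. Let $G_1$ be the subgraph of $G$ consisting of the edges of weight one. For a matching $M$, a $2$-cycle of $G_1$ (a pair of edges $(u,v),(v,u)$ both of weight one) is called $M$-hit if one of its two edges belongs to $M$. Let $\tilde G=(\tilde V,\tilde E)$ be obtained from $G$ by subdividing each edge $(u,v)$ belonging to an $M$-hit $2$-cycle of $G_1$ by a new vertex $x_{(u,v)}$ into two edges $(u,x_{(u,v)})$ and $(x_{(u,v)},v)$, each of weight $\frac12 w(u,v)$; these are called half-edges of $(u,v)$. All other edges of $G$ are kept with their weights. A cycle cover that evades $M$ is a subset $\tilde C\subseteq\tilde E$ such that (i) each vertex of $V$ has exactly one outgoing and exactly one incoming edge in $\tilde C$; (ii) for each $M$-hit $2$-cycle of $G_1$ on vertices $u,v$, $\tilde C$ contains either zero or two edges from $\{(u,x_{(u,v)}),(x_{(u,v)},v),(v,x_{(v,u)}),(x_{(v,u)},u)\}$,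 and if $\tilde C$ contains only one half-edge of $(u,v)$ then it also contains one half-edge of $(v,u)$, with one of these two half-edges incident with $u$ and the other incident with $v$. Its weight $w(\tilde C)$ is the sum of the weights of its elements. Construction of $G'=(V',E')$ (with $M=M_{max}$): for each $v\in V$ add vertices $v_{in},v_{out}$. For each edge $(u,v)\in E$ add vertices $e^1_{uv},e^2_{uv}$, an edge $\{e^1_{uv},e^2_{uv}\}$ of weight $0$, and edges $\{u_{out},e^1_{uv}\}$ and $\{v_{in},e^2_{uv}\}$, each of weight $\frac12 w(u,v)$. For each $M$-hit $2$-cycle of $G_1$ on vertices $u,v$ add vertices $a_{\{u,v\}},b_{\{u,v\}}$ and edges $\{a_{\{u,v\}},e^1_{uv}\}$, $\{a_{\{u,v\}},e^2_{vu}\}$, $\{b_{\{u,v\}},e^1_{vu}\}$, $\{b_{\{u,v\}},e^2_{uv}\}$, each of weight $0$. Correspondence: a perfect matching $N$ of $G'$ yields the set $\tilde C$ consisting of: each edge $(u,v)$ of $G$ not subdivided in $\tilde G$ such that $\{u_{out},e^1_{uv}\},\{v_{in},e^2_{uv}\}\in N$; and, for each subdivided edge $(u,v)$, the half-edge $(u,x_{(u,v)})$ if $\{u_{out},e^1_{uv}\}\in N$ and the half-edge $(x_{(u,v)},v)$ if $\{v_{in},e^2_{uv}\}\in N$. The weight of $\tilde C$ equals the weight of $N$. *)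

(* Defs.v *)
From HB Require Import structures.
From mathcomp Require Import all_boot all_order all_algebra.

Set Implicit Arguments.
Unset Strict Implicit.
Unset Printing Implicit Defensive.

Import Order.TTheory GRing.Theory Num.Theory.
Local Open Scope ring_scope.

Definition maximises (T : Type) (P : T -> Prop) (f : T -> rat) (x : T) : Prop :=
  P x /\ (forall y, P y -> f y <= f x).

Section CompleteDigraph.

Variable V : finType.

(* A directed edge (u, v) is the pair with tail u and head v.  Weights are
   functions on V * V whose diagonal values are never used. *)
Definition arcs : {set V * V} := [set e | e.1 != e.2].

Definition flip (e : V * V) : V * V := (e.2, e.1).

Definition ends (e : V * V) : {set V} := [set e.1; e.2].

Definition arcs_weight (w : V * V -> rat) (S : {set V * V}) : rat :=
  \sum_(e in S) w e.

Definition matching (M : {set V * V}) : Prop :=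
  M \subset arcs /\
  {in M &, forall e f, e != f -> [disjoint ends e & ends f]}.

Definition max_weight_matching (w : V * V -> rat) : {set V * V} -> Prop :=
  maximises matching (arcs_weight w).

Definition tour (c : seq V) : bool :=
  ucycleb (fun u v => (u, v) \in arcs) c && [forall v, v \in c].

Definition tour_weight (w : V * V -> rat) (c : seq V) : rat :=
  \sum_(v <- c) w (v, next c v).

(* Weights are nonnegative on arcs, so the default value 0 is immaterial as
   soon as there is a tour, i.e. as soon as #|V| >= 2. *)
Definition OPT (w : V * V -> rat) : rat :=
  \big[Num.max/0]_(c : #|V|.-tuple V | tour c) tour_weight w c.

Definition G1 (w : V * V -> rat) : {set V * V} := [set e in arcs | w e == 1].

(* e belongs to an M-hit 2-cycle of G_1. *)
Definition hit (w : V * V -> rat) (M : {set V * V}) (e : V * V) : bool :=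
  [&& e \in G1 w, flip e \in G1 w & (e \in M) || (flip e \in M)].

(* Vertices of the subdivided graph: inl v is the original vertex v, and
   inr (u, v) is x_(u,v). *)
Definition svert : Type := (V + V * V)%type.

Definition whole (e : V * V) : svert * svert := (inl e.1, inl e.2).
Definition half_tail (e : V * V) : svert * svert := (inl e.1, inr e).
Definition half_head (e : V * V) : svert * svert := (inr e, inl e.2).
Definition halves (e : V * V) : {set svert * svert} :=
  [set half_tail e; half_head e].

Definition sub_arcs (w : V * V -> rat) (M : {set V * V}) :
    {set svert * svert} :=
  [set whole e | e in [set e in arcs | ~~ hit w M e]] :|:
  \bigcup_(e in arcs | hit w M e) halves e.

Definition sub_weight (w : V * V -> rat) (h : svert * svert) : rat :=
  match h with
  | (inl u, inl v) => w (u, v)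
  | (inl _, inr e) => w e / 2
  | (inr e, inl _) => w e / 2
  | (inr _, inr _) => 0
  end.

Definition cover_weight (w : V * V -> rat) (C : {set svert * svert}) : rat :=
  \sum_(h in C) sub_weight w h.

Definition incident (h : svert * svert) (v : V) : bool :=
  (h.1 == inl v) || (h.2 == inl v).

Definition evading_cycle_cover (w : V * V -> rat) (M : {set V * V})
    (C : {set svert * svert}) : Prop :=
  [/\ C \subset sub_arcs w M,
      forall v : V, #|[set h in C | h.1 == inl v]| = 1%N /\
                    #|[set h in C | h.2 == inl v]| = 1%N,
      forall e, hit w M e ->
        #|C :&: (halves e :|: halves (flip e))| = 0%N \/
        #|C :&: (halves e :|: halves (flip e))| = 2%N
    & forall e, hit w M e -> #|C :&: halves e| = 1%N ->
        exists h h', [/\ C :&: halves e = [set h],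
                         C :&: halves (flip e) = [set h']
                       & (incident h e.1 && incident h' e.2) ||
                         (incident h e.2 && incident h' e.1)]].

(* Potential vertices of G'; those actually present are singled out by
   gadget_verts below. *)
Inductive gvert : Type :=
  | Vin of V
  | Vout of V
  | E1 of V * V
  | E2 of V * V
  | A of {set V}
  | B of {set V}.

Definition gvert_code (x : gvert) :
    V + (V + (V * V + (V * V + ({set V} + {set V})))) :=
  match x with
  | Vin v => inl v
  | Vout v => inr (inl v)
  | E1 e => inr (inr (inl e))
  | E2 e => inr (inr (inr (inl e)))
  | A s => inr (inr (inr (inr (inl s))))
  | B s => inr (inr (inr (inr (inr s))))
  end.

Definition gvert_decode
    (y : V + (V + (V * V + (V * V + ({set V} + {set V}))))) : gvert :=
  match y with
  | inl v => Vin v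
  | inr (inl v) => Vout v
  | inr (inr (inl e)) => E1 e
  | inr (inr (inr (inl e))) => E2 e
  | inr (inr (inr (inr (inl s)))) => A s
  | inr (inr (inr (inr (inr s)))) => B s
  end.

Lemma gvert_codeK : cancel gvert_code gvert_decode.
Proof. by case. Qed.

HB.instance Definition _ := Finite.copy gvert (can_type gvert_codeK).

(* Exchanging the names u and v of the two vertices of an M-hit 2-cycle only
   exchanges a_{u,v} and b_{u,v}.  We call (u, v) the edge of the 2-cycle
   that lies in M; it is unique when M is a matching. *)
Definition hit_cycles (w : V * V -> rat) (M : {set V * V}) : {set V * V} :=
  [set e in M | hit w M e].

Definition out_edge (e : V * V) : {set gvert} := [set Vout e.1; E1 e].
Definition in_edge (e : V * V) : {set gvert} := [set Vin e.2; E2 e].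

Definition gadget_verts (w : V * V -> rat) (M : {set V * V}) : {set gvert} :=
  [set Vin v | v in V] :|: [set Vout v | v in V] :|:
  [set E1 e | e in arcs] :|: [set E2 e | e in arcs] :|:
  [set A (ends e) | e in hit_cycles w M] :|:
  [set B (ends e) | e in hit_cycles w M].

Definition gadget_edges (w : V * V -> rat) (M : {set V * V}) :
    {set {set gvert}} :=
  [set [set E1 e; E2 e] | e in arcs] :|:
  [set out_edge e | e in arcs] :|:
  [set in_edge e | e in arcs] :|:
  [set [set A (ends e); E1 e] | e in hit_cycles w M] :|:
  [set [set A (ends e); E2 (flip e)] | e in hit_cycles w M] :|:
  [set [set B (ends e); E1 (flip e)] | e in hit_cycles w M] :|:
  [set [set B (ends e); E2 e] | e in hit_cycles w M].

Definition gadget_weight (w : V * V -> rat) (f : {set gvert}) : rat :=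
  if [pick e in arcs | (f == out_edge e) || (f == in_edge e)] is Some e
  then w e / 2 else 0.

Definition gadget_perfect_matching (w : V * V -> rat) (M : {set V * V})
    (N : {set {set gvert}}) : Prop :=
  [/\ N \subset gadget_edges w M, trivIset N & cover N = gadget_verts w M].

Definition gadget_max_perfect_matching (w : V * V -> rat) (M : {set V * V}) :
    {set {set gvert}} -> Prop :=
  maximises (gadget_perfect_matching w M)
            (fun N => \sum_(f in N) gadget_weight w f).

Definition cover_of (w : V * V -> rat) (M : {set V * V})
    (N : {set {set gvert}}) : {set svert * svert} :=
  [set whole e | e in [set e in arcs | [&& ~~ hit w M e, out_edge e \in N
                                         & in_edge e \in N]]] :|:
  [set half_tail e | e in [set e in arcs | hit w M e && (out_edge e \in N)]] :|:
  [set half_head e | e in [set e in arcs | hit w M e && (in_edge e \in N)]].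

End CompleteDigraph.

(* Main.v *)
Require Import Defs.
From mathcomp Require Import all_boot all_order all_algebra.
(* In an M-hit 2-cycle, a and b each consume one of the four edge vertices
   e^1, e^2, so going through the two choices for a and the two for b leaves
   exactly five possible sets of used half-edges, all of them allowed in an
   evading cycle cover.  Conversely a tour whose successor function traverses
   no M-hit 2-cycle in both directions extends to a perfect matching of the
   same weight, the two edges at u_out and v_in accounting for one half of
   w(u, v) each.  A tour through both edges of a 2-cycle exists only if
   |V| = 2, and when that 2-cycle is M-hit then G' has no perfect matching. *)

Set Implicit Arguments.
Unset Strict Implicit.
Unset Printing Implicit Defensive.
Import Order.TTheory GRing.Theory Num.Theory.
Local Open Scope ring_scope.

(** * Preliminaries: two-element sets, and tours seen through their successor function *)

Lemma set2_inj (T : finType) (x y z : T) : [set x; y] = [set x; z] -> y = z.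
Proof.
move=> eq_xyz; have: y \in [set x; z] by rewrite -eq_xyz set22.
case/set2P=> // eq_yx; have: z \in [set x; y] by rewrite eq_xyz set22.
by rewrite eq_yx => /set2P[].
Qed.

Lemma sum_setU (T : finType) (S S' : {set T}) (F : T -> rat) :
  [disjoint S & S'] ->
  \sum_(x in S :|: S') F x = \sum_(x in S) F x + \sum_(x in S') F x.
Proof. by move=> disS; rewrite -bigU //; apply: eq_bigl => x; rewrite !inE. Qed.

(** In a duplicate-free cycle every element is reached from any other by iterating [next], so a
    closed set that meets the cycle contains it. *)
Lemma next_closed (T : finType) (S : {set T}) (c : seq T) (x : T) :
  uniq c -> x \in c -> x \in S -> {in S, forall y, next c y \in S} ->
  {subset c <= S}.
Proof.
move=> Uc xc xS closedS y; rewrite -(fconnect_cycle (cycle_next Uc) xc).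
by move=> /iter_findex <-; elim: findex => //= n; apply: closedS.
Qed.

Lemma tour_next (V : finType) (c : seq V) :
  tour c -> [/\ uniq c, forall v, v \in c & forall v, next c v != v].
Proof.
case/andP=> /andP[cyc_c Uc] /forallP all_c; split=> // v.
by have := next_cycle cyc_c (all_c v); rewrite inE eq_sym.
Qed.

Lemma tour_weightE (V : finType) (w : V * V -> rat) (c : seq V) :
  tour c -> tour_weight w c = \sum_v w (v, next c v).
Proof.
case/tour_next=> Uc all_c _; rewrite /tour_weight big_uniq //=.
by apply: eq_bigl => v; rewrite all_c.
Qed.

Lemma enum_tour (V : finType) : (1 < #|V|)%N -> tour (enum V).
Proof.
move=> V_gt1; have all_c v : v \in enum V by rewrite mem_enum.
rewrite /tour /ucycleb enum_uniq andbT; apply/andP; split; last exact/forallP.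
apply: cycle_from_next (enum_uniq V) _ => v _; rewrite inE /= eq_sym.
(* A fixed point [v] of [next] would make the singleton of [v] closed, hence equal to the whole
   vertex set. *)
apply: contraL V_gt1 => /eqP next_v; rewrite -leqNgt -(cards1 v).
apply/subset_leq_card/subsetP => u _; apply: next_closed (all_c u) => //.
- exact: enum_uniq.
- exact: set11.
by move=> _ /set1P->; rewrite next_v set11.
Qed.

Section Gadget.

Variables (V : finType) (w : V * V -> rat) (M : {set V * V}).
Hypothesis matchingM : matching M.

Implicit Types (e : V * V) (s : {set V}) (x y : gvert V).
Implicit Types (N : {set {set gvert V}}).

Local Notation H := (hit_cycles w M).

(** * The $M$-hit 2-cycles, each represented by its edge in $M$ *)

Lemma flipK : involutive (@flip V). Proof. by case. Qed.

Lemma ends_flip e : ends (flip e) = ends e.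
Proof. by apply/setP => v; rewrite !inE orbC. Qed.

Lemma flip_arcs e : (flip e \in arcs V) = (e \in arcs V).
Proof. by rewrite !inE eq_sym. Qed.

Lemma hit_flip e : hit w M (flip e) = hit w M e.
Proof. by rewrite /hit flipK andbCA orbC. Qed.

Lemma hit_arcs e : hit w M e -> e \in arcs V.
Proof. by case/andP; rewrite inE => /andP[]. Qed.

Lemma hit_neq_flip e : hit w M e -> e != flip e.
Proof.
move=> /hit_arcs; rewrite inE; apply: contraNneq => eq_e.
by rewrite {1}eq_e.
Qed.

Lemma hit_cycles_hit e : e \in H -> hit w M e.
Proof. by rewrite inE => /andP[]. Qed.

Lemma hit_cyclesVflip e : hit w M e -> (e \in H) || (flip e \in H).
Proof.
by move=> hit_e; rewrite !inE hit_flip hit_e !andbT; case/and3P: hit_e.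
Qed.

Lemma hit_cycles_arcs e : e \in H -> e \in arcs V.
Proof. by move/hit_cycles_hit/hit_arcs. Qed.

(** Distinct edges of a matching share no endpoint. Hence the unordered pair that labels an [A] or
    [B] vertex determines the edge of [H] behind it. *)
Lemma hit_cycles_ends_inj : {in H &, injective (@ends V)}.
Proof.
move=> e f; rewrite !inE => /andP[eM _] /andP[fM _] eq_ends.
apply/eqP/negPn/negP => neq_ef.
have := (matchingM.2 _ _ eM fM neq_ef); rewrite eq_ends => /pred0P/(_ f.1).
by rewrite /= !inE eqxx.
Qed.

(** [flip e] has the same ends as [e], so only one orientation can lie in [H]; this fixes without
    ambiguity which vertex is $a$ and which is $b$. *)
Lemma hit_cycles_flip e : e \in H -> flip e \notin H.
Proof.
move=> eH; apply/negP => feH.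
have := hit_neq_flip (hit_cycles_hit eH).
by rewrite [flip e](@hit_cycles_ends_inj _ e) ?eqxx ?ends_flip.
Qed.

(** * Adjacency in $G'$ *)

(** Adjacency is read off the constructors, so that the neighbours of a vertex come out by
    computation rather than by inverting the images in [gadget_edges]. The conditions [flip e \in H]
    describe the edge of a hit 2-cycle opposite to the one in [M]. *)
Definition nbr x y : bool :=
  match x, y with
  | Vout v, E1 e | E1 e, Vout v => (e \in arcs V) && (v == e.1)
  | Vin v, E2 e | E2 e, Vin v => (e \in arcs V) && (v == e.2)
  | E1 e, E2 f | E2 f, E1 e => (e \in arcs V) && (f == e)
  | A s, E1 e | E1 e, A s => (e \in H) && (s == ends e)
  | A s, E2 e | E2 e, A s => (flip e \in H) && (s == ends e)
  | B s, E1 e | E1 e, B s => (flip e \in H) && (s == ends e)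
  | B s, E2 e | E2 e, B s => (e \in H) && (s == ends e)
  | _, _ => false
  end.

Lemma nbrC : symmetric nbr.
Proof. by case=> ? []. Qed.

Lemma gadget_edge_nbr h :
  h \in gadget_edges w M -> exists x y, h = [set x; y] /\ nbr x y.
Proof.
rewrite 6!in_setU -!orbA.
case/or4P=> [|||/or4P[]] /imsetP[e eP ->]; do 2!eexists; (split; first by []);
  by rewrite /= ?flipK ?ends_flip ?eP ?eqxx.
Qed.

Lemma nbr_gadget_edge x y : nbr x y -> [set x; y] \in gadget_edges w M.
Proof.
have edgeP e : e \in arcs V -> [/\ [set E1 e; E2 e] \in gadget_edges w M,
    out_edge e \in gadget_edges w M & in_edge e \in gadget_edges w M].
  by move=> eP; split; do ?[by apply/setUP; right; apply/imsetP; exists e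
                           |by apply/imsetP; exists e | apply/setUP; left].
have hitP e : e \in H -> [/\ [set A (ends e); E1 e] \in gadget_edges w M,
    [set A (ends e); E2 (flip e)] \in gadget_edges w M,
    [set B (ends e); E1 (flip e)] \in gadget_edges w M &
    [set B (ends e); E2 e] \in gadget_edges w M].
  by move=> eP; split; do ?[by apply/setUP; right; apply/imsetP; exists e
                           |by apply/imsetP; exists e | apply/setUP; left].
(* The retained patterns list the two endpoints in the order in which [gadget_edges] writes them. *)
wlog: x y / match x, y with
    | Vout _, E1 _ | Vin _, E2 _ | E1 _, E2 _ | A _, _ | B _, _ => true
    | _, _ => false end => [th_sym|].
  move=> xy; have yx : nbr y x by rewrite nbrC.
  move: (th_sym x y) (th_sym y x) xy yx; rewrite (setUC [set y]).
  by case: x y => [v|v|e|e|s|s] [v'|v'|e'|e'|s'|s'] // th1 th2 xy yx;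
    first [exact: th1 | exact: th2].
case: x y => [v|v|e|e|s|s] [v'|v'|e'|e'|s'|s'] //= _ /andP[eP /eqP->];
  try by have [] := edgeP _ eP.
all: by have [] := hitP _ eP; rewrite ?flipK ?ends_flip.
Qed.

Lemma gadget_vertsE x :
  (x \in gadget_verts w M) = match x with
    | Vin _ | Vout _ => true
    | E1 e | E2 e => e \in arcs V
    | A s | B s => s \in [set ends e | e in H]
    end.
Proof.
apply/idP/idP.
  rewrite 5!in_setU -!orbA.
  by case/or4P=> [|||/or3P[]] /imsetP[e eP ->] //; apply: imset_f.
case: x => [v|v|e|e|s|s].
1,2: move=> _; do ?[by apply/setUP; right; apply/imsetP; exists v
                   |by apply/imsetP; exists v | apply/setUP; left].
1,2: move=> eP; do ?[by apply/setUP; right; apply/imsetP; exists e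
                   |by apply/imsetP; exists e | apply/setUP; left].
all: case/imsetP=> e eP ->.
all: by do ?[by apply/setUP; right; apply/imsetP; exists e
                   |by apply/imsetP; exists e | apply/setUP; left].
Qed.

(** * Local structure of a perfect matching of $G'$ *)

Section PerfectMatching.

Variable N : {set {set gvert V}}.
Hypothesis perfectN : gadget_perfect_matching w M N.

Lemma mate_uniq x y z : [set x; y] \in N -> [set x; z] \in N -> y = z.
Proof.
case: perfectN => _ /trivIsetP trivN _ xyN xzN; apply: (@set2_inj _ x).
apply/eqP/negPn/negP => /(trivN _ _ xyN xzN)/pred0P/(_ x).
by rewrite /= !inE eqxx.
Qed.

Lemma mate_ex x :
  x \in gadget_verts w M -> exists2 y, [set x; y] \in N & nbr x y.
Proof.
case: perfectN => /subsetP subN _ <- /bigcupP[h hN].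
have [y [z [eq_h yz]]] := gadget_edge_nbr (subN _ hN); subst h.
case/set2P=> ->; first by exists z.
by exists y; [rewrite setUC | rewrite nbrC].
Qed.

Lemma out_ex v : exists2 e, out_edge e \in N & (e \in arcs V) && (v == e.1).
Proof.
have [|y] := @mate_ex (Vout v); first by rewrite gadget_vertsE.
case: y => // e vN /andP[eP /eqP def_v].
by exists e; rewrite ?eP /out_edge -def_v ?eqxx.
Qed.

Lemma in_ex v : exists2 e, in_edge e \in N & (e \in arcs V) && (v == e.2).
Proof.
have [|y] := @mate_ex (Vin v); first by rewrite gadget_vertsE.
case: y => // e vN /andP[eP /eqP def_v].
by exists e; rewrite ?eP /in_edge -def_v ?eqxx.
Qed.

Lemma out_uniq e f : out_edge e \in N -> out_edge f \in N -> e.1 = f.1 -> e = f.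
Proof.
rewrite /out_edge => eN + eq_ef; rewrite -eq_ef => fN.
by case: (mate_uniq eN fN).
Qed.

Lemma in_uniq e f : in_edge e \in N -> in_edge f \in N -> e.2 = f.2 -> e = f.
Proof.
rewrite /in_edge => eN + eq_ef; rewrite -eq_ef => fN.
by case: (mate_uniq eN fN).
Qed.

(* The default value, for an x not covered by N, is x itself. *)
Definition mate x := odflt x [pick y | [set x; y] \in N].

Lemma mateE x y : [set x; y] \in N -> mate x = y.
Proof.
move=> xyN; rewrite /mate; case: pickP => [z /mate_uniq|/(_ y)]; first exact.
by rewrite xyN.
Qed.

Lemma mate_nbr x :
  x \in gadget_verts w M -> nbr x (mate x) /\ [set x; mate x] \in N.
Proof. by move=> /mate_ex[y xyN xy]; rewrite (mateE xyN). Qed.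

Lemma mate_sym x y : x \in gadget_verts w M -> mate x = y -> mate y = x.
Proof. by move=> /mate_nbr[_ xN] <-; apply: mateE; rewrite setUC. Qed.

Lemma mem_mate x y :
  x \in gadget_verts w M -> ([set x; y] \in N) = (mate x == y).
Proof. by case/mate_nbr=> _ xN; apply/idP/eqP => [/mateE | <-]. Qed.

Lemma out_edgeE e :
  e \in arcs V -> (out_edge e \in N) = (mate (E1 e) == Vout e.1).
Proof. by move=> eP; rewrite /out_edge setUC mem_mate ?gadget_vertsE. Qed.

Lemma in_edgeE e :
  e \in arcs V -> (in_edge e \in N) = (mate (E2 e) == Vin e.2).
Proof. by move=> eP; rewrite /in_edge setUC mem_mate ?gadget_vertsE. Qed.

(** The neighbours of $e^1$ are the out-vertex, $e^2$, and $a$ or $b$ according to which edge of the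
    2-cycle lies in [M]. All cases but the first also record the mate of the mate, so that
    incompatible choices later clash as plain equations. *)
Lemma mate_E1 e : e \in arcs V ->
  [\/ mate (E1 e) = Vout e.1,
      mate (E1 e) = E2 e /\ mate (E2 e) = E1 e,
      [/\ e \in H, mate (E1 e) = A (ends e) & mate (A (ends e)) = E1 e] |
      [/\ flip e \in H, mate (E1 e) = B (ends e)
        & mate (B (ends e)) = E1 e]].
Proof.
move=> eP; have eG : E1 e \in gadget_verts w M by rewrite gadget_vertsE.
have [+ _] := mate_nbr eG; have := mate_sym eG erefl.
case: (mate (E1 e)) => //=.
- by move=> ? _ /andP[_ /eqP->]; constructor 1.
- by move=> ? + /andP[_ /eqP def_e]; rewrite def_e; constructor 2.
- by move=> ? + /andP[eH /eqP def_s]; rewrite def_s; constructor 3.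
- by move=> ? + /andP[eH /eqP def_s]; rewrite def_s; constructor 4.
Qed.

Lemma mate_E2 e : e \in arcs V ->
  [\/ mate (E2 e) = Vin e.2,
      mate (E2 e) = E1 e /\ mate (E1 e) = E2 e,
      [/\ flip e \in H, mate (E2 e) = A (ends e) & mate (A (ends e)) = E2 e] |
      [/\ e \in H, mate (E2 e) = B (ends e) & mate (B (ends e)) = E2 e]].
Proof.
move=> eP; have eG : E2 e \in gadget_verts w M by rewrite gadget_vertsE.
have [+ _] := mate_nbr eG; have := mate_sym eG erefl.
case: (mate (E2 e)) => //=.
- by move=> ? _ /andP[_ /eqP->]; constructor 1.
- by move=> ? + /andP[_ /eqP def_e]; rewrite def_e; constructor 2.
- by move=> ? + /andP[eH /eqP def_s]; rewrite def_s; constructor 3.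
- by move=> ? + /andP[eH /eqP def_s]; rewrite def_s; constructor 4.
Qed.

(** By [hit_cycles_ends_inj] the label [ends e] comes from [e] alone, which leaves $a$ with two
    neighbours. *)
Lemma mate_A e : e \in H ->
  mate (A (ends e)) = E1 e /\ mate (E1 e) = A (ends e) \/
  mate (A (ends e)) = E2 (flip e) /\ mate (E2 (flip e)) = A (ends e).
Proof.
move=> eH; have eG : A (ends e) \in gadget_verts w M.
  by rewrite gadget_vertsE imset_f.
have [+ _] := mate_nbr eG; have := mate_sym eG erefl.
case: (mate (A (ends e))) => [||f|f||] //= m_f /andP[fH /eqP eq_ends].
  by left; rewrite (hit_cycles_ends_inj eH fH eq_ends) in m_f *.
rewrite -(ends_flip f) in eq_ends.
by right; rewrite (hit_cycles_ends_inj eH fH eq_ends) flipK in m_f *.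
Qed.

Lemma mate_B e : e \in H ->
  mate (B (ends e)) = E2 e /\ mate (E2 e) = B (ends e) \/
  mate (B (ends e)) = E1 (flip e) /\ mate (E1 (flip e)) = B (ends e).
Proof.
move=> eH; have eG : B (ends e) \in gadget_verts w M.
  by rewrite gadget_vertsE imset_f.
have [+ _] := mate_nbr eG; have := mate_sym eG erefl.
case: (mate (B (ends e))) => [||f|f||] //= m_f /andP[fH /eqP eq_ends].
  rewrite -(ends_flip f) in eq_ends.
  by right; rewrite (hit_cycles_ends_inj eH fH eq_ends) flipK in m_f *.
by left; rewrite (hit_cycles_ends_inj eH fH eq_ends) in m_f *.
Qed.

(** Away from the hit 2-cycles, $e^1$ and $e^2$ have one neighbour each besides one another: either
    they are matched together and no half of [e] is used, or both halves are. *)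
Lemma out_in_edge e :
  e \in arcs V -> ~~ hit w M e -> (out_edge e \in N) = (in_edge e \in N).
Proof.
move=> eP nhit_e; rewrite out_edgeE // in_edgeE //.
have nH f : hit w M f = hit w M e -> (f \in H) = false.
  by rewrite inE => ->; rewrite (negPf nhit_e) andbF.
case: (mate_E1 eP) => [||[]|[]]; rewrite ?nH ?hit_flip //; last first.
  by case=> -> ->.
case: (mate_E2 eP) => [||[]|[]]; rewrite ?nH ?hit_flip //; last first.
  by case=> -> ->.
by move=> -> ->; rewrite !eqxx.
Qed.

(* An entry lists the presence of the tail half and of the head half of e,
   then the same for flip e. *)
Definition hit_states : seq (bool * bool * (bool * bool)) :=
  [:: ((false, false), (false, false)); ((true, true), (false, false));
      ((false, false), (true, true)); ((true, false), (true, false));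
      ((false, true), (false, true))].

Definition usage e := (out_edge e \in N, in_edge e \in N).

Lemma hit_stateP e : hit w M e -> (usage e, usage (flip e)) \in hit_states.
Proof.
(* [hit_states] is stable under exchanging the components of its pairs, so [e] may be taken to be
   the edge in [M]. *)
move=> hit_e; wlog eH: e hit_e / e \in H => [th|].
  case/orP: (hit_cyclesVflip hit_e) => eH; first exact: th.
  have := th (flip e); rewrite hit_flip flipK => /(_ hit_e eH).
  by move: (usage e) (usage _) => [[] []] [[] []].
have eP := hit_arcs hit_e; have feP : flip e \in arcs V by rewrite flip_arcs.
have /negPf nfH := hit_cycles_flip eH.
rewrite /usage !out_edgeE // !in_edgeE //.
have e1 := mate_E1 eP; have e2 := mate_E2 eP.
have := mate_E1 feP; have := mate_E2 feP.
rewrite flipK eH ends_flip nfH in e1 e2 *.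
(* The choices for $a$ and $b$ meet the possible mates of the four edge vertices; [congruence]
   rejects the combinations that give a vertex two mates, and each survivor is looked up in the
   list. *)
case: (mate_A eH) (mate_B eH) e1 e2 => [] [mA mA'] [] [mB mB'];
 (case=> [m1|[m1 m1']|[_ m1 m1']|[] // _ m1 m1']);
 (case=> [m2|[m2 m2']|[] // _ m2 m2'|[_ m2 m2']]);
 try congruence;
 (case=> [m3|[m3 m3']|[_ m3 m3']|[] // _ m3 m3']);
 (case=> [m4|[m4 m4']|[] // _ m4 m4'|[_ m4 m4']]);
 try congruence; by rewrite m1 m2 m3 m4 ?eqxx.
Qed.

(** * The set of edges and half-edges read off the matching is an evading cycle cover *)

Lemma mem_cover_of h :
  (h \in cover_of w M N) = match h with
    | (inl u, inl v) => [&& (u, v) \in arcs V, ~~ hit w M (u, v),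
                            out_edge (u, v) \in N & in_edge (u, v) \in N]
    | (inl u, inr e) => [&& hit w M e, out_edge e \in N & u == e.1]
    | (inr e, inl v) => [&& hit w M e, in_edge e \in N & v == e.2]
    | _ => false
    end.
Proof.
apply/idP/idP.
  rewrite /cover_of => /setUP[/setUP[]|] /imsetP[e /setIdP[eA eP] ->] /=.
  - by rewrite -surjective_pairing eA.
  - by rewrite eqxx andbT.
  - by rewrite eqxx andbT.
case: h => [[u|e] [v|f]] //= => [uvP|/and3P[fH fN /eqP->]|/and3P[eH eN /eqP->]].
- apply/setUP; left; apply/setUP; left; apply/imsetP; exists (u, v) => //.
  exact/setIdP/andP.
- apply/setUP; left; apply/setUP; right; apply/imsetP; exists f => //.
  by apply/setIdP; rewrite hit_arcs // fH.
- apply/setUP; right; apply/imsetP; exists e => //.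
  by apply/setIdP; rewrite hit_arcs // eH.
Qed.

Lemma cover_of_sub : cover_of w M N \subset sub_arcs w M.
Proof.
apply/subsetP => h; rewrite mem_cover_of.
case: h => [[u|e] [v|f]] //
  => [/and4P[uvP nhit _ _]|/and3P[fH _ /eqP->]|/and3P[eH _ /eqP->]].
- by apply/setUP; left; apply/imsetP; exists (u, v) => //; apply/setIdP.
- apply/setUP; right; apply/bigcupP; exists f; rewrite ?hit_arcs //.
  exact: set21.
- apply/setUP; right; apply/bigcupP; exists e; rewrite ?hit_arcs //.
  exact: set22.
Qed.

(** The mate of [Vout v] selects one edge [e] leaving [v]. If [e] is hit, its tail half is the
    outgoing element; otherwise [out_in_edge] supplies the other half, so [e] is present as a
    whole. *)
Lemma cover_of_out v : #|[set h in cover_of w M N | h.1 == inl v]| = 1%N.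
Proof.
have [e eN /andP[eP /eqP->]] := out_ex v.
apply/eqP/cards1P; exists (if hit w M e then half_tail e else whole e).
apply/setP => h; rewrite in_set1 inE mem_cover_of.
case: h => [[u|g] [x|f]] /=; try (by rewrite ?andbF; case: (hit w M e)).
- case: ifP => hit_e; apply/idP/idP.
  + case/andP => /and4P[_ nhit uxN _] /eqP[eq_u].
    by move: nhit; rewrite (out_uniq uxN eN eq_u) hit_e.
  + by case/eqP.
  + case/andP => /and4P[_ _ uxN _] /eqP[eq_u].
    by rewrite -(out_uniq uxN eN eq_u).
  case/eqP=> -> ->; rewrite -surjective_pairing eP hit_e eN.
  by rewrite -out_in_edge ?eN ?hit_e ?eqxx.
apply/idP/idP => [/andP[/and3P[hit_f fN /eqP->] /eqP[eq_u]]|].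
  by rewrite -(out_uniq fN eN eq_u) hit_f.
case: ifP => hit_e /eqP[] // -> ->.
by rewrite hit_e eN !eqxx.
Qed.

Lemma cover_of_in v : #|[set h in cover_of w M N | h.2 == inl v]| = 1%N.
Proof.
have [e eN /andP[eP /eqP->]] := in_ex v.
apply/eqP/cards1P; exists (if hit w M e then half_head e else whole e).
apply/setP => h; rewrite in_set1 inE mem_cover_of.
case: h => [[u|g] [x|f]] /=;
  try by case: (hit w M e); rewrite /half_head /whole xpair_eqE !andbF.
- case: ifP => hit_e; apply/idP/idP.
  + apply/negP; case/andP => /and4P[_ nhit _ uxN] /eqP[eq_u].
    by move: nhit; rewrite (in_uniq uxN eN eq_u) hit_e.
  + case/andP => /and4P[_ _ _ uxN] /eqP[eq_u].
    by rewrite -(in_uniq uxN eN eq_u).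
  case/eqP=> -> ->; rewrite -surjective_pairing eP hit_e eN.
  by rewrite out_in_edge ?eN ?hit_e ?eqxx.
apply/idP/idP => [/andP[/and3P[hit_f fN /eqP->] /eqP[eq_u]]|].
  by rewrite -(in_uniq fN eN eq_u) hit_f.
case: ifP => hit_e /eqP[] // -> ->.
by rewrite hit_e eN !eqxx.
Qed.

(** With this formula, the conditions on hit 2-cycles become a finite check over [hit_states]. *)
Lemma cover_of_halves e : hit w M e ->
  cover_of w M N :&: halves e =
    (if out_edge e \in N then [set half_tail e] else set0) :|:
    (if in_edge e \in N then [set half_head e] else set0).
Proof.
move=> hit_e.
have tailE : (half_tail e \in cover_of w M N) = (out_edge e \in N).
  by rewrite mem_cover_of /= hit_e eqxx andbT.
have headE : (half_head e \in cover_of w M N) = (in_edge e \in N).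
  by rewrite mem_cover_of /= hit_e eqxx andbT.
rewrite /halves setIUr -tailE -headE; congr (_ :|: _); apply/setP => h;
  rewrite inE in_set1; (have [->|neq_h] := eqVneq; last rewrite andbF);
  by case: ifP; rewrite ?in_set0 ?in_set1 ?eqxx ?(negPf neq_h).
Qed.

Lemma cover_of_evading : evading_cycle_cover w M (cover_of w M N).
Proof.
split; first exact: cover_of_sub.
- by move=> v; rewrite cover_of_out cover_of_in.
- move=> e hit_e; rewrite setIUr !cover_of_halves ?hit_flip //.
  (* In the two mixed states the cover takes both tails or both heads; they must be distinct for the
     count to be two. *)
  have neq_tail : half_tail e != half_tail (flip e).
    by apply: contraNneq (hit_neq_flip hit_e) => eq_h;
      case: eq_h => *; apply/eqP.
  have neq_head : half_head e != half_head (flip e).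
    by apply: contraNneq (hit_neq_flip hit_e) => eq_h;
      case: eq_h => *; apply/eqP.
  have := hit_stateP hit_e; rewrite /usage.
  case: (out_edge e \in N); case: (in_edge e \in N);
    case: (out_edge (flip e) \in N); case: (in_edge (flip e) \in N) => //= _;
    rewrite ?setU0 ?set0U ?cards0 ?cards2 ?neq_tail ?neq_head; auto.
move=> e hit_e; rewrite !cover_of_halves ?hit_flip //.
have := hit_stateP hit_e; rewrite /usage.
case: (out_edge e \in N); case: (in_edge e \in N);
  case: (out_edge (flip e) \in N); case: (in_edge (flip e) \in N) => //= _.
all: rewrite ?setU0 ?set0U ?cards0 ?cards2 //.
(* Only the mixed states contain a single half of [e]. The two tails leave [e.1] and [e.2]; in the
   next case the two heads enter [e.2] and [e.1]. *)
- move=> _; exists (half_tail e), (half_tail (flip e)); split=> //.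
  by rewrite /incident !eqxx.
- move=> _; exists (half_head e), (half_head (flip e)); split=> //.
  by rewrite /incident /= !eqxx !orbT.
Qed.

(** A whole edge is counted as two halves, which [out_in_edge] allows. The right-hand side is also
    that of [gadget_weight_sum], whence the cover weighs as much as [N]. *)
Lemma cover_of_weight : cover_weight w (cover_of w M N) =
  \sum_(e in arcs V)
     (w e / 2 *+ (out_edge e \in N) + w e / 2 *+ (in_edge e \in N)).
Proof.
rewrite /cover_weight /cover_of !sum_setU; first last.
- rewrite disjoints_subset; apply/subsetP => _ /setUP[]/imsetP[e _ ->];
    by rewrite inE; apply/negP => /imsetP[].
- rewrite disjoints_subset; apply/subsetP => _ /imsetP[e _ ->];
    by rewrite inE; apply/negP => /imsetP[].
rewrite !big_imset /=; first last.
- by move=> [u v] [u' v'] _ _ [-> ->].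
- by move=> e f _ _ [].
- by move=> e f _ _ [].
rewrite 3!big_set !big_mkcondr -!big_split /=; apply: eq_bigr => e eP.
have [hit_e|nhit_e] /= := boolP (hit w M e).
  by rewrite add0r; do 2![case: ifP => _].
rewrite -surjective_pairing out_in_edge // andbb !addr0.
by case: ifP => _; rewrite ?addr0 -?splitr.
Qed.

End PerfectMatching.

(** * Weights of the edges of $G'$ *)

Lemma out_edge_inj : injective (@out_edge V).
Proof.
move=> e f eq_ef; have : E1 e \in out_edge f by rewrite -eq_ef set22.
by case/set2P => // -[].
Qed.

Lemma in_edge_inj : injective (@in_edge V).
Proof.
move=> e f eq_ef; have : E2 e \in in_edge f by rewrite -eq_ef set22.
by case/set2P => // -[].
Qed.

Lemma out_edge_neq_in e f : (out_edge e == in_edge f) = false.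
Proof.
apply/eqP => eq_ef; have : E1 e \in in_edge f by rewrite -eq_ef set22.
by case/set2P.
Qed.

(** At most one term is nonzero, since [out_edge] and [in_edge] are injective with disjoint images.
    This removes the choice made by [pick] and permits exchanging sums. *)
Lemma gadget_weightE h : gadget_weight w h =
  \sum_(e in arcs V)
     (w e / 2 *+ (h == out_edge e) + w e / 2 *+ (h == in_edge e)).
Proof.
rewrite /gadget_weight; case: pickP => [e /andP[eP /orP eh]|no_edge].
  rewrite (bigD1 e) //= [X in _ + X]big1 => [|f /andP[_ /negPf neq_fe]].
    by case: eh => /eqP->; rewrite eqxx ?out_edge_neq_in 1?eq_sym
      ?out_edge_neq_in ?addr0 ?add0r.
  case: eh => /eqP->; rewrite ?(inj_eq out_edge_inj) ?(inj_eq in_edge_inj).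
    by rewrite out_edge_neq_in eq_sym neq_fe addr0.
  rewrite [in_edge _ == out_edge _]eq_sym out_edge_neq_in eq_sym neq_fe.
  exact: addr0.
rewrite big1 // => e eP; have /negbT := no_edge e.
by rewrite eP /= negb_or => /andP[/negPf-> /negPf->].
Qed.

Lemma sum_indicator (T : finType) (S : {set T}) (k : T) (c : rat) :
  \sum_(h in S) c *+ (h == k) = c *+ (k \in S).
Proof.
have [kS|nkS] := boolP (k \in S).
  by rewrite (bigD1 k) //= eqxx big1 ?addr0 // => h /andP[_ /negPf->].
by rewrite big1 // => h hS; case: eqP nkS => // <-; rewrite hS.
Qed.

Lemma gadget_weight_sum N : \sum_(h in N) gadget_weight w h =
  \sum_(e in arcs V)
     (w e / 2 *+ (out_edge e \in N) + w e / 2 *+ (in_edge e \in N)).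
Proof.
under eq_bigr do rewrite gadget_weightE.
rewrite exchange_big /=; apply: eq_bigr => e _.
by rewrite big_split /= !sum_indicator.
Qed.

(** * From a fixed-point-free permutation of the vertices to a perfect matching of $G'$ *)

Section SuccessorMatching.

Variables succ pred : V -> V.
Hypotheses (succK : cancel succ pred) (predK : cancel pred succ).
Hypothesis succ_neq : forall v, succ v != v.

Definition used e := e.2 == succ e.1.

Hypothesis hit_used : forall e, hit w M e -> used e -> ~~ used (flip e).

(* The vertices e^1, e^2 of an unused edge e are matched together, except in
   an M-hit 2-cycle: there a and b absorb the vertices of the edge of the
   2-cycle that lies in M if it is unused, and those of its flip otherwise. *)
Definition partner x : gvert V :=
  match x with
  | Vin v => E2 (pred v, v)
  | Vout v => E1 (v, succ v)
  | E1 e => if used e then Vout e.1 else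
            if e \in H then A (ends e) else
            if (flip e \in H) && used (flip e) then B (ends e) else E2 e
  | E2 e => if used e then Vin e.2 else
            if e \in H then B (ends e) else
            if (flip e \in H) && used (flip e) then A (ends e) else E1 e
  | A s => if [pick e in H | ends e == s] is Some e
           then if used e then E2 (flip e) else E1 e else A s
  | B s => if [pick e in H | ends e == s] is Some e
           then if used e then E1 (flip e) else E2 e else B s
  end.

Lemma used_succ v : used (v, succ v). Proof. exact: eqxx. Qed.

Lemma used_pred v : used (pred v, v). Proof. by rewrite /used predK. Qed.

Lemma used_arcs e : used e -> e \in arcs V.
Proof. by move=> /eqP def_e; rewrite inE eq_sym def_e. Qed.

Lemma pick_ends e : e \in H -> [pick f in H | ends f == ends e] = Some e.
Proof.
move=> eH; case: pickP => [f /andP[fH /eqP eq_ends]|/(_ e)].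
  by rewrite (hit_cycles_ends_inj fH eH eq_ends).
by rewrite eH eqxx.
Qed.

Lemma partner_nbr x : x \in gadget_verts w M -> nbr x (partner x).
Proof.
rewrite gadget_vertsE; case: x => [v|v|e|e|s|s] /=.
- by rewrite used_arcs ?eqxx ?used_pred.
- by rewrite used_arcs ?eqxx ?used_succ.
- move=> eP; case: ifP => _ /=; first by rewrite eP eqxx.
  case: ifP => /= [_|_]; first by rewrite eqxx.
  by case: ifP => [/andP[-> _]|_]; rewrite ?eP eqxx.
- move=> eP; case: ifP => _ /=; first by rewrite eP eqxx.
  case: ifP => /= [_|_]; first by rewrite eqxx.
  by case: ifP => [/andP[-> _]|_]; rewrite ?eP eqxx.
- case/imsetP=> e eH ->; rewrite pick_ends //.
  by case: ifP => _ /=; rewrite ?flipK eH ?ends_flip eqxx.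
- case/imsetP=> e eH ->; rewrite pick_ends //.
  by case: ifP => _ /=; rewrite ?flipK eH ?ends_flip eqxx.
Qed.

(** [E1 e] and [E2 e] undergo the same tests in the same order, so their fallbacks point at each
    other; the other branches are undone by the [pick] at [A] and [B]. *)
Lemma partnerK : {in gadget_verts w M, involutive partner}.
Proof.
have flip_state e : e \in H -> used e ->
    [/\ used (flip e) = false, (flip e \in H) = false & ends (flip e) = ends e].
  move=> eH e_used; rewrite ends_flip (negPf (hit_cycles_flip eH)).
  by rewrite (negPf (hit_used (hit_cycles_hit eH) e_used)).
move=> x; rewrite gadget_vertsE; case: x => [v|v|e|e|s|s] /=.
- by rewrite used_pred.
- by rewrite used_succ.
- move=> eP; case e_used: (used e) => /=.
    by move: e_used => /eqP <-; rewrite -surjective_pairing.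
  case eH: (e \in H) => /=; first by rewrite pick_ends // e_used.
  case: ifP => [/andP[feH fe_used]|feH] /=; last by rewrite e_used eH feH.
  by rewrite -ends_flip pick_ends // fe_used flipK.
- move=> eP; case e_used: (used e) => /=.
    move: (e_used) => /eqP ->; rewrite succK.
    by rewrite -(eqP e_used) -surjective_pairing.
  case eH: (e \in H) => /=; first by rewrite pick_ends // e_used.
  case: ifP => [/andP[feH fe_used]|feH] /=; last by rewrite e_used eH feH.
  by rewrite -ends_flip pick_ends // fe_used flipK.
- case/imsetP=> e eH ->; rewrite pick_ends //.
  case e_used: (used e) => /=; last by rewrite e_used eH.
  by have [-> -> ->] := flip_state _ eH e_used; rewrite flipK eH e_used.
- case/imsetP=> e eH ->; rewrite pick_ends //.
  case e_used: (used e) => /=; last by rewrite e_used eH.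
  by have [-> -> ->] := flip_state _ eH e_used; rewrite flipK eH e_used.
Qed.

Lemma nbr_vert x y : nbr x y -> x \in gadget_verts w M.
Proof.
rewrite gadget_vertsE.
case: x y => [v|v|e|e|s|s] [v'|v'|f|f|t|t] //= /andP[eP /eqP def_x];
  first [exact: eP | by rewrite def_x | exact: hit_cycles_arcs
        | by rewrite -flip_arcs hit_cycles_arcs
        | by rewrite def_x imset_f | by rewrite def_x -ends_flip imset_f].
Qed.

Definition succ_matching : {set {set gvert V}} :=
  [set [set x; partner x] | x in gadget_verts w M].

Lemma partner_vert x :
  x \in gadget_verts w M -> partner x \in gadget_verts w M.
Proof. by move/partner_nbr; rewrite nbrC => /nbr_vert. Qed.

Lemma mem_succ_matching x y : x \in gadget_verts w M ->
  ([set x; y] \in succ_matching) = (y == partner x).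
Proof.
move=> xG; apply/imsetP/eqP => [[z zG eq_xy]|->]; last by exists x.
have: x \in [set z; partner z] by rewrite -eq_xy set21.
case/set2P=> def_x; first by move: eq_xy; rewrite -def_x => /set2_inj.
rewrite setUC in eq_xy; rewrite def_x partnerK //.
by move: eq_xy; rewrite def_x setUC [RHS]setUC => /set2_inj.
Qed.

(** The blocks are the orbits of the involution [partner], so they partition the vertices;
    [partner_nbr] makes them edges. *)
Lemma succ_matching_perfect : gadget_perfect_matching w M succ_matching.
Proof.
split.
- apply/subsetP => _ /imsetP[x xG ->].
  exact: nbr_gadget_edge (partner_nbr xG).
- apply/trivIsetP => _ _ /imsetP[x xG ->] /imsetP[y yG ->].
  apply: contraR => /pred0Pn[z /= /andP[zx zy]].
  have pair_eq t : t \in gadget_verts w M -> z \in [set t; partner t] ->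
      [set t; partner t] = [set z; partner z].
    by move=> tG /set2P[] -> //; rewrite partnerK // setUC.
  by rewrite (pair_eq x) // (pair_eq y).
apply/setP => x; apply/bigcupP/idP => [[_ /imsetP[y yG ->] /set2P[]->]|xG] //.
  exact: partner_vert.
by exists [set x; partner x]; [apply: imset_f | apply: set21].
Qed.

Lemma succ_matching_weight :
  \sum_(h in succ_matching) gadget_weight w h = \sum_v w (v, succ v).
Proof.
have used_out e : e \in arcs V -> (out_edge e \in succ_matching) = used e.
  case: e => u v eP; rewrite /out_edge mem_succ_matching ?gadget_vertsE //=.
  by apply/eqP/eqP => [[->]|/= ->].
have used_in e : e \in arcs V -> (in_edge e \in succ_matching) = used e.
  case: e => u v eP; rewrite /in_edge mem_succ_matching ?gadget_vertsE //=.
  by apply/eqP/eqP => [[->]|/= ->]; rewrite /= ?predK ?succK.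
rewrite gadget_weight_sum (eq_bigr (fun e => if used e then w e else 0)).
  (* A used edge contributes both halves and is determined by its tail. *)
  rewrite -big_mkcondr (reindex_onto (fun v => (v, succ v)) fst) /=.
    by apply: eq_bigl => v; rewrite used_succ used_arcs ?used_succ ?eqxx.
  by move=> [u v] /andP[_ /eqP /= ->].
move=> e eP; rewrite used_out ?used_in //.
by case: ifP => _; rewrite ?addr0 -?splitr.
Qed.

End SuccessorMatching.

(** * Tours, the two-vertex exception, and maximum perfect matchings *)

Lemma tour_matching c : tour c ->
    (forall e, hit w M e -> used (next c) e -> ~~ used (next c) (flip e)) ->
  exists2 N, gadget_perfect_matching w M N &
             \sum_(h in N) gadget_weight w h = tour_weight w c.
Proof.
move=> tour_c hit_c; have [Uc _ next_neq] := tour_next tour_c.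
exists (succ_matching (next c) (prev c)).
  exact: succ_matching_perfect (prev_next Uc) (next_prev Uc) _ _.
by rewrite (succ_matching_weight (prev_next Uc) (next_prev Uc)) ?tour_weightE.
Qed.

(** The two ends of [e] form a set closed under [next]. *)
Lemma tour_two_cycle c e :
  tour c -> used (next c) e -> used (next c) (flip e) -> ends e = setT.
Proof.
case/tour_next=> Uc all_c _ /eqP e_used /eqP fe_used.
apply/setP => v; rewrite in_setT.
apply: (@next_closed _ (ends e) c e.1 Uc (all_c _) (set21 _ _)) => // u.
case/set2P=> ->.
  by rewrite -e_used set22.
by rewrite -fe_used set21.
Qed.

(** The only arcs are [e] and [flip e], so the in- and out-vertices force all four halves into [N],
    a state absent from [hit_states]. *)
Lemma two_vertices_imperfect N e :
  hit w M e -> ends e = setT -> ~ gadget_perfect_matching w M N.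
Proof.
move=> hit_e ends_e perfectN.
have out_eN f : f.1 != f.2 -> ends f = setT -> out_edge f \in N.
  move=> neq_f ends_f; have [g gN /andP[gP /eqP eq_fg]] := out_ex perfectN f.1.
  rewrite [f]surjective_pairing eq_fg; suff <- : g.2 = f.2.
    by rewrite -surjective_pairing.
  have: g.2 \in ends f by rewrite ends_f.
  by case/set2P=> // eq_gf; move: gP; rewrite inE eq_gf eq_fg eqxx.
have in_eN f : f.1 != f.2 -> ends f = setT -> in_edge f \in N.
  move=> neq_f ends_f; have [g gN /andP[gP /eqP eq_fg]] := in_ex perfectN f.2.
  rewrite [f]surjective_pairing eq_fg; suff <- : g.1 = f.1.
    by rewrite -surjective_pairing.
  have: g.1 \in ends f by rewrite ends_f.
  by case/set2P=> // eq_gf; move: gP; rewrite inE eq_gf eq_fg eqxx.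
have neq_e : e.1 != e.2 by have := hit_arcs hit_e; rewrite inE.
have := hit_stateP perfectN hit_e.
by rewrite /usage !out_eN ?in_eN ?ends_flip // eq_sym.
Qed.

Lemma max_perfect_matching_ex N :
  gadget_perfect_matching w M N ->
  exists N', gadget_max_perfect_matching w M N'.
Proof.
pose perfect N' := [&& N' \subset gadget_edges w M, trivIset N' &
                       cover N' == gadget_verts w M].
have perfectP N' : reflect (gadget_perfect_matching w M N') (perfect N').
  by apply: (iffP and3P) => -[? ? /eqP].
move/perfectP=> perfectN; pose weight N' := \sum_(h in N') gadget_weight w h.
have [N' /perfectP perfectN' maxN'] :=
  @arg_maxP _ _ _ N perfect weight perfectN.
by exists N'; split=> // N'' /perfectP; apply: maxN'.
Qed.

End Gadget.

Theorem theorem2 (V : finType) (w : V * V -> rat)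
    (hw : forall e, e \in arcs V -> w e = 0 \/ w e = 1)
    (Mmax : {set V * V}) (hM : max_weight_matching w Mmax) :
  (forall N, gadget_perfect_matching w Mmax N ->
     evading_cycle_cover w Mmax (cover_of w Mmax N)) /\
  ((2 < #|V|)%N -> exists N, gadget_max_perfect_matching w Mmax N) /\
  (forall N, gadget_max_perfect_matching w Mmax N ->
     evading_cycle_cover w Mmax (cover_of w Mmax N) /\
     OPT w <= cover_weight w (cover_of w Mmax N)).
Proof.
have matchingM := hM.1.
split; first by move=> N; apply: cover_of_evading.
split=> [V_gt2 | N [perfectN maxN]].
  have tour_c := enum_tour (ltnW V_gt2).
  have [e _ e_used|N perfectN _] :=
    @tour_matching _ w _ matchingM _ tour_c; last first.
    exact: max_perfect_matching_ex perfectN.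
  (* A tour through both [e] and [flip e] would leave at most two vertices. *)
  apply: contraL V_gt2 => fe_used; rewrite -leqNgt -cardsT.
  by rewrite -(tour_two_cycle tour_c e_used fe_used) cards2; case: eqP.
split; first exact: cover_of_evading.
rewrite (cover_of_weight perfectN) -gadget_weight_sum.
(* The first goal compares with the default value 0 of the maximum and follows from nonnegative
   weights. *)
apply: bigmax_le => [|c tour_c].
  rewrite gadget_weight_sum; apply: sumr_ge0 => e eP.
  have w_ge0 : 0 <= w e / 2 by case: (hw e eP) => ->.
  by rewrite addr_ge0 ?mulrn_wge0.
have [e hit_e e_used|N' perfectN' <-] :=
  @tour_matching _ w _ matchingM _ tour_c.
  apply/negP => fe_used.
  have ends_e := tour_two_cycle tour_c e_used fe_used.
  (* In the exceptional case the given perfect matching [N] cannot exist. *)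
  by case: (two_vertices_imperfect matchingM hit_e ends_e perfectN).
exact: maxN.
Qed.
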